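(* There exists a density-like ideal on $\omega$ which is not a generalized density ideal.
   Context: $\omega=\{0,1,2,\dots\}$, and each $n\in\omega$ is identified with $\{0,\dots,n-1\}$. An ideal on $\omega$ is a family of subsets of $\omega$ closed under subsets and finite unions; all ideals are assumed to contain every finite subset of $\omega$ and not to contain $\omega$. A lower semicontinuous submeasure (lscsm) on $\omega$ is a function $\varphi:\mathcal{P}(\omega)\to[0,\infty]$ that is monotone and subadditive, with $\varphi(\emptyset)=0$, $\varphi(\{n\})<\infty$ for all $n$, and $\varphi(A)=\lim_n\varphi(A\cap n)$ for all $A\subseteq\omega$. Its support is $\mathrm{supp}(\varphi)=\{n\in\omega:\varphi(\{n\})\neq 0\}$. Put $\|A\|_\varphi=\inf\{\varphi(A\setminus F): F\subseteq\omega\text{ finite}\}$ and $\mathrm{Exh}(\varphi)=\{A\subseteq\omega:\|A\|_\varphi=0\}$. An ideal $\mathcal{I}$ is a generalized density ideal if $\mathcal{I}=\mathrm{Exh}(\sup_n\mu_n)$ (pointwise supremum) for some sequence $(\mu_n)_{n\in\omega}$ of lscsms with finite pairwise disjoint supports. A lscsm $\varphi$ is density-like if for all $\varepsilon>0$ there is $\delta>0$ such that, whenever $(F_n)_{n\in\omega}$ is a sequence of nonempty finite pairwise disjoint subsets of $\omega$ with $\varphi(F_n)<\delta$ for all $n$, there is an infinite $I\subseteq\omega$ with $\varphi(\bigcup_{i\in I}F_i)<\varepsilon$. An ideal $\mathcal{I}$ is density-like if $\mathcal{I}=\mathrm{Exh}(\varphi)$ for some density-like lscsm $\varphi$. *)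

(* Defs.v *)
From HB Require Import structures.
From mathcomp Require Import all_boot all_order all_algebra.
From mathcomp Require Import all_classical all_reals all_analysis.
Set Implicit Arguments.
Unset Strict Implicit.
Unset Printing Implicit Defensive.
Import Order.TTheory GRing.Theory Num.Theory.
Import numFieldNormedType.Exports.

Local Open Scope classical_set_scope.
Local Open Scope ring_scope.
Local Open Scope ereal_scope.

Record is_ideal (I : set (set nat)) : Prop := IsIdeal {
  ideal_sub : forall A B, A `<=` B -> I B -> I A ;
  ideal_setU : forall A B, I A -> I B -> I (A `|` B) ;
  ideal_finite : forall A, finite_set A -> I A ;
  ideal_proper : ~ I setT }.

Section Submeasures.
Variable R : realType.
Implicit Type phi : set nat -> \bar R.

(* lscsm: lower semicontinuous submeasure; [`I_n] is {0, ..., n-1} *)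
Record is_lscsm phi : Prop := IsLscsm {
  lscsm_ge0 : forall A, 0 <= phi A ;
  lscsm_set0 : phi set0 = 0 ;
  lscsm_le : forall A B, A `<=` B -> phi A <= phi B ;
  lscsm_setU : forall A B, phi (A `|` B) <= phi A + phi B ;
  lscsm_fin : forall n, phi [set n] < +oo ;
  lscsm_lsc : forall A, phi (A `&` `I_n) @[n --> \oo] --> phi A }.

Definition supp phi : set nat := [set n | phi [set n] <> 0].

Definition exh_norm phi (A : set nat) : \bar R :=
  ereal_inf [set phi (A `\` F) | F in [set F : set nat | finite_set F]].

Definition Exh phi : set (set nat) := [set A | exh_norm phi A = 0].

Definition sup_seq (mu : nat -> set nat -> \bar R) (A : set nat) : \bar R :=
  ereal_sup [set mu n A | n in [set: nat]].

Definition generalized_density_ideal (I : set (set nat)) : Prop :=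
  is_ideal I /\
  exists mu : nat -> set nat -> \bar R,
    [/\ forall n, is_lscsm (mu n),
        forall n, finite_set (supp (mu n)),
        trivIset [set: nat] (fun n => supp (mu n)) &
        I = Exh (sup_seq mu)].

Definition density_like phi : Prop :=
  forall eps : R, (0 < eps)%R ->
  exists2 delta : R, (0 < delta)%R &
    forall F : nat -> set nat,
      (forall n, F n !=set0) ->
      (forall n, finite_set (F n)) ->
      trivIset [set: nat] F ->
      (forall n, phi (F n) < delta%:E) ->
      exists2 I : set nat, infinite_set I &
        phi (\bigcup_(i in I) F i) < eps%:E.

Definition density_like_ideal (I : set (set nat)) : Prop :=
  is_ideal I /\
  exists phi, [/\ is_lscsm phi, density_like phi & I = Exh phi].

End Submeasures.

Arguments generalized_density_ideal R I : clear implicits.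
Arguments density_like_ideal R I : clear implicits.

(* Main.v *)
Require Import Defs.
From mathcomp Require Import all_boot all_order all_algebra.
From mathcomp Require Import all_classical all_reals all_analysis.
From mathcomp Require Import lra zify.

(** Colour the natural numbers so that every colour [a] is used infinitely
    often, and give [a] the weight [1 / (a + 1)]. For a set [A], let [phi A] be
    the supremum over [M] of the total weight of the colours [a < M] of the
    elements [x >= M] of [A]. The witnessing ideal is [Exh phi].

    It is density-like. Let [F_i] be finite, nonempty, pairwise disjoint, with
    [phi (F_i) < delta]. Let [B] be the limit, along a free ultrafilter, of the
    sets of colours used by the [F_i]. Every finite part of [B] consists of
    colours of some [F_i] lying arbitrarily far out, so [B] has weight at most
    [delta]. Choose a subsequence in which each set uses, below a bound
    exceeding all elements of the earlier sets, only colours of [B]. For a given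
    [M], the colours counted in the union are then in [B], or are already
    counted for one single set of the subsequence. Hence the union has
    submeasure at most [2 delta].

    It is not a generalized density ideal. Let [mu_n] have finite pairwise
    disjoint supports, and suppose that [Exh (sup_n mu_n) = Exh phi]. Choose
    for every colour [a] a point [s_a > 2a] of colour [a], no two of them in the
    same support. The set of all [s_a] is not in [Exh phi], because at
    [M = 2n + 1] all colours from [n] to [2n] are counted. So infinitely many of
    the points [s_a] are singletons of [sup_n mu_n]-measure above some fixed
    [c > 0], and no infinite set of such points is in [Exh (sup_n mu_n)]. But if
    the points are taken so sparse that the colour of each exceeds all earlier
    points, then for each [M] at most one colour is counted, and its weight
    tends to zero: that infinite set is in [Exh phi]. *)

Set Implicit Arguments.
Unset Strict Implicit.
Unset Printing Implicit Defensive.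
Import Order.TTheory GRing.Theory Num.Theory.

Local Open Scope classical_set_scope.
Local Open Scope ring_scope.

(** * Bounds and subsequences *)

Lemma finite_nat_bound (A : set nat) : finite_set A -> exists m, A `<=` `I_m.
Proof.
move=> /finite_seqP[s ->]; exists (\max_(x <- s) x).+1 => x /= xs.
by rewrite ltnS (leq_bigmax_seq (F := id)).
Qed.

(** Repeated choice, where each term is chosen beyond a bound [h] attached to
    the earlier ones; the requirement [P k N] on the [k]-th term may become
    stronger as the bound [N] grows. *)
Lemma sparse_sequence (P : nat -> nat -> nat -> Prop) (h : nat -> nat) :
  (forall k N N' x, (N <= N')%N -> P k N' x -> P k N x) ->
  (forall k N, exists2 x, (N <= x)%N & P k N x) ->
  exists s : nat -> nat, (forall k, P k 0%N (s k)) /\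
    forall i j, (i < j)%N -> (h (s i) <= s j)%N /\ P j (h (s i)) (s j).
Proof.
move=> Panti Pex.
have /choice[f fP] kN : exists x, (kN.2 <= x)%N /\ P kN.1 kN.2 x.
  by have [x] := Pex kN.1 kN.2; exists x.
pose M k := iteri k (fun k N => maxn N (h (f (k, N)))) 0%N.
have leM : {homo M : i j / (i <= j)%N}.
  by apply: homo_leq => // [? ? ?|i]; [exact: leq_trans|exact: leq_maxl].
exists (fun k => f (k, M k)); split=> [k|i j ij].
  by apply: Panti (fP (k, M k)).2.
have hM : (h (f (i, M i)) <= M j)%N.
  exact: leq_trans (leq_maxr _ _) (leM _ _ ij).
have [/= le_f Pf] := fP (j, M j).
by split; [exact: leq_trans le_f|exact: Panti Pf].
Qed.

Lemma increasing_ge_id (s : nat -> nat) :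
  (forall i j, (i < j)%N -> (s i < s j)%N) -> forall k, (k <= s k)%N.
Proof. by move=> ss; elim=> // k IH; exact: leq_ltn_trans (ss k _ _). Qed.

Lemma unbounded_infinite (A : set nat) :
  (forall N, exists2 x, A x & (N <= x)%N) -> infinite_set A.
Proof.
move=> Aunb /finite_nat_bound[m Am]; have [x Ax mx] := Aunb m.
by have := Am x Ax; rewrite /= ltnNge mx.
Qed.

(** * Exhaustive ideals *)

Section exhaustive.
Variable R : realType.
Implicit Type phi : set nat -> \bar R.

Lemma ExhP phi (A : set nat) :
  (forall B, 0 <= phi B)%E -> (forall B C, B `<=` C -> phi B <= phi C)%E ->
  Exh phi A <-> forall e : R, 0 < e -> exists N, (phi (A `\` `I_N) < e%:E)%E.
Proof.
move=> phi0 phile; split=> [A0 e e0|A0].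
  have : (exh_norm phi A < e%:E)%E by rewrite A0 lte_fin.
  move=> /ereal_inf_lt[_ [F /finite_nat_bound[N FN] <-] lte].
  exists N; apply: le_lt_trans lte; apply: phile => x [Ax NIx].
  by split=> // /FN.
apply/eqP; rewrite eq_le; apply/andP; split; last first.
  by apply/ereal_infP => _ [F _ <-].
apply/lee_addgt0Pr => e e0; rewrite add0e.
have [N lte] := A0 e e0; apply: ge_ereal_inf.
exists (phi (A `\` `I_N)); last exact: ltW.
by exists `I_N => //; exact: finite_II.
Qed.

Lemma is_ideal_Exh phi :
  is_lscsm phi -> ~ Exh phi setT -> is_ideal (Exh phi).
Proof.
case=> phi0 phi00 phile phiU _ _ NT; have EP := ExhP _ phi0 phile.
split=> //.
- move=> A B AB /EP BE; apply/EP => e e0; have [N lte] := BE e e0.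
  by exists N; apply: le_lt_trans lte; apply: phile; exact: setSD.
- move=> A B /EP AE /EP BE; apply/EP => e e0.
  have e20 : 0 < e / 2 by rewrite divr_gt0.
  have [N Ne] := AE _ e20; have [M Me] := BE _ e20.
  exists (maxn N M).
  rewrite [e]splitr EFinD; apply: le_lt_trans (lteD Ne Me).
  apply: le_trans (phiU _ _); apply: phile => x [+ /=].
  by move=> [Ax|Bx] /negP; rewrite -leqNgt geq_max => /andP[? ?];
    [left|right]; split=> //=; apply/negP; rewrite -leqNgt.
- move=> A /finite_nat_bound[m Am]; apply/EP => e e0; exists m.
  by rewrite (_ : A `\` `I_m = set0) ?phi00 ?lte_fin// setD_eq0.
Qed.

(** A lower semicontinuous submeasure lives on its support. *)
Lemma lscsm_supp phi (E : set nat) :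
  is_lscsm phi -> (phi E <= phi (E `&` supp phi))%E.
Proof.
case=> phi0 phi00 phile phiU _ lsc.
suff E0 : phi (E `\` supp phi) = 0%E.
  apply: (@le_trans _ _ (phi ((E `&` supp phi) `|` (E `\` supp phi)))).
    by rewrite setUIDK.
  by apply: le_trans (phiU _ _) _; rewrite E0 adde0.
have En n : phi ((E `\` supp phi) `&` `I_n) = 0%E.
  elim: n => [|n IH]; first by rewrite II0 setI0.
  apply/eqP; rewrite eq_le phi0 andbT.
  have -> : (0 = 0 + 0 :> \bar R)%E by rewrite adde0.
  have [[En NSn]|Nn] := pselect ((E `\` supp phi) n).
    rewrite -{1}IH -(contrapT NSn); apply: le_trans (phiU _ _); apply: phile.
    move=> x [Ex /=]; rewrite ltnS leq_eqVlt => /orP[/eqP->|xn]; first by right.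
    by left.
  rewrite adde0 -IH; apply: phile => x [Ex /=].
  rewrite ltnS leq_eqVlt => /orP[/eqP xn|//].
  by exfalso; apply: Nn; rewrite -xn.
have := lsc (E `\` supp phi).
under eq_fun do rewrite En.
by move/(cvg_lim (@ereal_hausdorff R)) => <-; rewrite lim_cst//; exact: ereal_hausdorff.
Qed.

End exhaustive.

(** * The submeasure *)

(** The colour of [x] is the exponent of [2] in [x + 1]. Only the fact that
    every colour is used infinitely often matters. *)
Definition colour (x : nat) : nat := logn 2 x.+1.

Lemma colour_unbounded a N : exists2 x, (N <= x)%N & colour x = a.
Proof.
exists ((N.*2.+1 * 2 ^ a).-1).
  by have := expn_gt0 2 a; rewrite /=; nia.
rewrite /colour prednK ?muln_gt0 ?expn_gt0//.
by rewrite logn_Gauss ?pfactorK// coprime2n /= odd_double.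
Qed.

(** The colours below [M] that [A] uses at or above [M]. *)
Definition late_colours (A : set nat) (M : nat) : set nat :=
  [set a | (a < M)%N /\ exists x, [/\ A x, (M <= x)%N & colour x = a]].

Section submeasure.
Variable R : realType.

(** The sum of [1 / (a + 1)] over the [a < M] in [T]. *)
Definition harmonic_weight (M : nat) (T : set nat) : R :=
  \sum_(a < M | (a : nat) \in T) a.+1%:R^-1.

(** The supremum over [M] of the weight of the colours below [M] that [A] uses
    at or above [M]. *)
Definition colour_submeasure (A : set nat) : \bar R :=
  ereal_sup (range (fun M => (harmonic_weight M (late_colours A M))%:E)).

Local Notation wt := harmonic_weight.
Local Notation phi := colour_submeasure.

Lemma harmonic_weight_ge0 M T : 0 <= wt M T.
Proof. by apply: sumr_ge0 => a _; rewrite invr_ge0. Qed.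

Lemma le_harmonic_weight M (S T : set nat) :
  (forall a, (a < M)%N -> S a -> T a) -> wt M S <= wt M T.
Proof.
move=> ST; rewrite /wt [leLHS]big_mkcond [leRHS]big_mkcond /=.
apply: ler_sum => a _; case: ifPn => [/set_mem Sa|_].
  by rewrite ifT //; apply/mem_set/ST.
by case: ifP => // _; rewrite invr_ge0.
Qed.

Lemma harmonic_weightU M (S T : set nat) : wt M (S `|` T) <= wt M S + wt M T.
Proof.
rewrite /wt big_mkcond [X in _ <= X + _]big_mkcond [X in _ <= _ + X]big_mkcond /=.
rewrite -big_split /=; apply: ler_sum => a _; rewrite in_setU.
have a0 : 0 <= a.+1%:R^-1 :> R by rewrite invr_ge0.
by case: (_ \in S); case: (_ \in T); rewrite /= ?addr0 ?add0r ?lerDl.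
Qed.

Lemma harmonic_weight_subsingleton M k (T : set nat) :
  (forall a, T a -> (k <= a)%N) -> (forall a b, T a -> T b -> a = b) ->
  wt M T <= k.+1%:R^-1.
Proof.
move=> Tk T1; rewrite /wt.
have [[a [aM Ta]]|NT] := pselect (exists a, (a < M)%N /\ T a).
  rewrite (bigD1 (Ordinal aM)) /=; last exact/mem_set.
  rewrite big1 ?addr0; last first.
    move=> i /andP[/set_mem Ti /negP Ni]; exfalso; apply: Ni.
    by apply/eqP/val_inj => /=; exact: T1.
  by rewrite lef_pV2 ?posrE// ler_nat ltnS Tk.
rewrite big1 ?invr_ge0// => i /set_mem Ti; exfalso; apply: NT.
by exists i.
Qed.

Lemma harmonic_weight_block n (T : set nat) :
  (forall a, (n <= a < n.*2.+1)%N -> T a) -> 2^-1 <= wt n.*2.+1 T.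
Proof.
move=> nT.
apply: (@le_trans _ _ (wt n.*2.+1 [set a | (n <= a)%N])); last first.
  by apply: le_harmonic_weight => a aM na; apply: nT; rewrite na.
rewrite /wt.
rewrite (eq_bigl (fun a : 'I_n.*2.+1 => (n <= a)%N)); last first.
  by move=> a; apply/idP/idP => [/set_mem//|na]; apply/mem_set.
rewrite -(big_mkord (fun a => (n <= a)%N) (fun a => (a.+1%:R^-1 : R))).
rewrite -(big_nat_widenl n 0 _ xpredT)//.
apply: (@le_trans _ _ (\sum_(n <= i < n.*2.+1) (n.*2.+1%:R^-1 : R))).
  rewrite sumr_const_nat -[leRHS]mulr_natl (_ : (n.*2.+1 - n = n.+1)%N); last by lia.
  rewrite ler_pdivlMr ?ltr0n// mulrC ler_pdivrMr//.
  by rewrite -natrM ler_nat; lia.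
apply: ler_sum_nat => i /andP[_ iM].
by rewrite lef_pV2 ?posrE// ler_nat.
Qed.

Lemma late_coloursS (A B : set nat) M :
  A `<=` B -> late_colours A M `<=` late_colours B M.
Proof. by move=> AB a [aM [x [/AB Bx Mx xa]]]; split=> //; exists x. Qed.

Lemma colour_submeasure_ge A M :
  ((wt M (late_colours A M))%:E <= phi A)%E.
Proof. by apply: ereal_sup_ubound; exists M. Qed.

Lemma colour_submeasure_le A (c : R) :
  (forall M, wt M (late_colours A M) <= c) -> (phi A <= c%:E)%E.
Proof. by move=> Ac; apply: ge_ereal_sup => _ [M _ <-]; rewrite lee_fin. Qed.

Lemma colour_submeasure_ge0 A : (0 <= phi A)%E.
Proof.
by apply: le_trans (colour_submeasure_ge A 0); rewrite lee_fin harmonic_weight_ge0.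
Qed.

Lemma colour_submeasureS (A B : set nat) : A `<=` B -> (phi A <= phi B)%E.
Proof.
move=> AB; apply: ge_ereal_sup => _ [M _ <-].
apply: le_trans (colour_submeasure_ge B M); rewrite lee_fin.
by apply: le_harmonic_weight => a _; exact: late_coloursS.
Qed.

(** Each [late_colours A M] is determined by a finite part of [A], whence lower
    semicontinuity. *)
Lemma late_colours_finite (A : set nat) M :
  exists n, late_colours A M `<=` late_colours (A `&` `I_n) M.
Proof.
have /choice[f fP] a : exists x, late_colours A M a ->
    [/\ A x, (M <= x)%N & colour x = a].
  have [[_ [x xP]]|Na] := pselect (late_colours A M a); first by exists x.
  by exists 0%N.
exists (\max_(a < M) f a).+1 => a Aa; have [Af Mf fa] := fP a Aa.
have aM := Aa.1; split=> //; exists (f a); split=> //; split=> //=.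
by rewrite ltnS (leq_bigmax (Ordinal aM)).
Qed.

Lemma is_lscsm_colour_submeasure : is_lscsm phi.
Proof.
split.
- exact: colour_submeasure_ge0.
- apply/eqP; rewrite eq_le colour_submeasure_ge0 andbT.
  apply: colour_submeasure_le => M; rewrite /wt big1// => i /set_mem.
  by case=> _ [x []].
- exact: colour_submeasureS.
- move=> A B; apply: ge_ereal_sup => _ [M _ <-].
  apply: le_trans (leeD (colour_submeasure_ge A M) (colour_submeasure_ge B M)).
  rewrite -EFinD lee_fin; apply: le_trans (harmonic_weightU _ _ _).
  apply: le_harmonic_weight => a _ [aM [x [ABx Mx xa]]].
  by case: ABx => ?; [left|right]; split=> //; exists x.
- move=> n; apply: (@le_lt_trans _ _ 1%:E); last exact: ltry.
  apply: colour_submeasure_le => M; rewrite -invr1.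
  apply: (@harmonic_weight_subsingleton _ 0) => // a b.
  by move=> [_ [x [-> _ <-]]] [_ [y [-> _ <-]]].
- move=> A.
  have -> : phi A = ereal_sup (range (fun n => phi (A `&` `I_n))).
    apply/eqP; rewrite eq_le; apply/andP; split; last first.
      by apply: ge_ereal_sup => _ [n _ <-]; exact: colour_submeasureS.
    apply: ge_ereal_sup => _ [M _ <-]; have [n An] := late_colours_finite A M.
    apply: le_ereal_sup_tmp; exists (phi (A `&` `I_n)); first by exists n.
    apply: le_trans (colour_submeasure_ge _ M); rewrite lee_fin.
    by apply: le_harmonic_weight => a _; exact: An.
  apply: ereal_nondecreasing_cvgn => n m nm; apply: colour_submeasureS.
  by move=> x [Ax xn]; split=> //=; exact: leq_trans nm.
Qed.

(** If every colour [a] is used by [A] beyond [2a], then a tail of [A] starting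
    at [n] still counts, at [M = 2n + 1], the colours from [n] to [2n], whose
    total weight is at least one half. *)
Lemma not_Exh_colour_submeasure (A : set nat) :
  (forall a, exists2 x, A x & (a.*2 < x)%N /\ colour x = a) -> ~ Exh phi A.
Proof.
move=> Acol /(ExhP _ colour_submeasure_ge0 colour_submeasureS) AE.
have [|N] := AE 2^-1; first by rewrite invr_gt0.
apply/negP; rewrite -leNgt.
apply: le_trans (colour_submeasure_ge _ N.*2.+1); rewrite lee_fin.
apply: harmonic_weight_block => a /andP[Na aN]; split=> //.
have [x Ax [ax xa]] := Acol a; exists x; split=> //; last by lia.
by split=> //=; lia.
Qed.

(** At most one term can be at or above [M] and have a colour below [M]: for two
    such terms, the colour of the later one exceeds the earlier one. *)
Lemma Exh_colour_submeasure_sparse (t : nat -> nat) :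
  (forall i j, (i < j)%N -> (t i < t j)%N /\ (t i < colour (t j))%N) ->
  Exh phi (range t).
Proof.
move=> tP; apply/(ExhP _ colour_submeasure_ge0 colour_submeasureS) => e e0.
have t_ge := increasing_ge_id (fun i j ij => (tP i j ij).1).
pose k := Num.truncn e^-1; exists (t k).+1.
apply: (@le_lt_trans _ _ (k.+1%:R^-1)%:E); last first.
  by rewrite lte_fin invf_plt ?posrE// truncnS_gt.
apply: colour_submeasure_le => M; apply: harmonic_weight_subsingleton.
- move=> a [_ [_ [[[j _ <-] /= tkj] _ <-]]].
  have kj : (k < j)%N.
    rewrite ltnNge; apply/negP; rewrite leq_eqVlt => /orP[/eqP jk|/tP[]]; last lia.
    by rewrite jk in tkj; lia.
  by have := tP _ _ kj; have := t_ge k; lia.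
- move=> a b [aM [_ [[[i _ <-] _] Mi ia]]] [bM [_ [[[j _ <-] _] Mj jb]]].
  by case: (ltngtP i j) => [/tP[]|/tP[]|ij]; [lia|lia|rewrite -ia -jb ij].
Qed.

Lemma density_like_colour_submeasure : density_like phi.
Proof.
move=> eps eps0; exists (eps / 3) => [|F F0 Ffin Fdis Fd]; first by rewrite divr_gt0.
have /choice[h0 h0P] i : exists m, F i `<=` `I_m by exact: finite_nat_bound.
pose h i := maxn i.+1 (h0 i).
have Fh i x : F i x -> (x < h i)%N.
  by move=> /h0P /= xh; rewrite /h leq_max xh orbT.
have [U [UU oU]] := @ultraFilterLemma nat (@nbhs _ _ \oo) _.
(* The limit along [U] of the sets of colours of the [F i]. *)
pose B := [set a | U [set i | (colour @` F i) a]].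
have UB N : U [set i | forall a, (a < N)%N -> (colour @` F i) a <-> B a].
  elim: N => [|N IH]; first by apply: filterS filterT.
  have : U [set i | (colour @` F i) N <-> B N].
    have [UN|UN] := in_ultra_setVsetC [set i | (colour @` F i) N] UU.
      by apply: filterS (UN) => i Fi; split.
    apply: filterS (UN) => i Fi; split=> // BN; exfalso.
    by have [j []] := filter_ex (filterI UN BN).
  move=> UN; apply: filterS (filterI IH UN) => i [IHi FN] a.
  by rewrite ltnS leq_eqVlt => /orP[/eqP->//|]; exact: IHi.
have Uge N : U [set i | (N <= i)%N] by apply: oU; exact: nbhs_infty_ge.
(* Pairwise disjointness makes the sets move to infinity. *)
have UF N : U [set i | forall x, (x < N)%N -> ~ F i x].
  elim: N => [|N IH]; first by apply: filterS filterT.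
  have [m mP] : exists m, forall i, (m <= i)%N -> ~ F i N.
    have [[i0 Fi0]|NF] := pselect (exists i, F i N).
      exists i0.+1 => i i0i FiN.
      have := Fdis i0 i I I; rewrite /= => ii; move: i0i; rewrite ii ?ltnn//.
      by exists N.
    by exists 0%N => i _ FiN; apply: NF; exists i.
  apply: filterS (filterI IH (Uge m)) => i [IHi mi] x.
  by rewrite ltnS leq_eqVlt => /orP[/eqP->|/IHi//]; exact: mP.
(* Some [F i] has the same colours below [M] as [B] and no element below [M], so
   that all these colours count in its submeasure. *)
have Bd M : wt M B <= eps / 3.
  have [i [iB iF]] := filter_ex (filterI (UB M) (UF M)).
  rewrite -lee_fin; apply: le_trans (ltW (Fd i)).
  apply: le_trans (colour_submeasure_ge _ M); rewrite lee_fin.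
  apply: le_harmonic_weight => a aM /(iB a aM).2 [x Fx xa].
  split=> //; exists x; split=> //; rewrite leqNgt; apply/negP => xM.
  exact: (iF x).
have [s [_ sP]] := @sparse_sequence
  (fun _ N i => forall a, (a < N)%N -> (colour @` F i) a -> B a) h
  (fun _ N N' i NN' H a aN => H a (leq_trans aN NN'))
  (fun _ N => let: ex_intro i (conj iN iB) := filter_ex (filterI (Uge N) (UB N)) in
     ex_intro2 _ _ i iN (fun a aN => (iB a aN).1)).
have s_incr i j : (i < j)%N -> (s i < s j)%N.
  by move=> /sP[+ _]; apply: leq_trans; exact: leq_maxl.
have s_ge := increasing_ge_id s_incr.
exists (range s).
  by apply: unbounded_infinite => N; exists (s N).
apply: (@le_lt_trans _ _ (eps / 3 + eps / 3)%:E); last by rewrite lte_fin; lra.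
apply: colour_submeasure_le => M.
(* The sets before [F (s k)] lie below [M], and those after it have only colours
   of [B] below [h (s k) >= M]. *)
have [k Mk kmin] : exists2 k, (M <= h (s k))%N &
    forall j, (j < k)%N -> (h (s j) < M)%N.
  have exM : exists k, (M <= h (s k))%N.
    by exists M; rewrite /h leq_max (leqW (s_ge M)).
  have [k Mk kmin] := ex_minnP exM; exists k => // j jk.
  by rewrite ltnNge; apply/negP => /kmin; rewrite leqNgt jk.
apply: (@le_trans _ _ (wt M (B `|` late_colours (F (s k)) M))); last first.
  apply: le_trans (harmonic_weightU _ _ _) _; apply: lerD (Bd M) _.
  by rewrite -lee_fin; apply: le_trans (ltW (Fd (s k))); exact: colour_submeasure_ge.
apply: le_harmonic_weight => a aM [_ [x [[_ [j _ <-] Fx] Mx xa]]].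
case: (ltngtP j k) => [jk|kj|jk].
- by have := Fh _ _ Fx; have := kmin _ jk; lia.
- by left; apply: (sP _ _ kj).2; [exact: leq_trans Mk|exists x].
- by right; split=> //; exists x; rewrite -jk.
Qed.

End submeasure.

(** * Generalized density ideals *)

Section generalized_density.
Variable R : realType.

(** A set with one point of each colour [a], beyond [2a], that meets each of
    the given disjoint finite sets in at most one point. *)
Lemma colour_selector (S : nat -> set nat) :
  (forall n, finite_set (S n)) -> trivIset setT S ->
  exists s : nat -> nat, [/\ forall i j, (i < j)%N -> (s i < s j)%N,
    forall a, (a.*2 < s a)%N /\ colour (s a) = a &
    forall n i j, S n (s i) -> S n (s j) -> i = j].
Proof.
move=> Sfin Sdis.
have /choice[h0 h0P] x : exists m, forall n y, S n x -> S n y -> (y < m)%N.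
  have [[n Sx]|NS] := pselect (exists n, S n x); last first.
    by exists 0%N => n y Sx; exfalso; apply: NS; exists n.
  have [m Sm] := finite_nat_bound (Sfin n); exists m => n' y Sx' Sy.
  apply: Sm; rewrite (Sdis n n' I I _)//; by exists x.
have [//||s [s0 sP]] := @sparse_sequence
  (fun a _ x => (a.*2 < x)%N /\ colour x = a) (fun x => maxn x.+1 (h0 x)).
  move=> a N; have [x + xa] := colour_unbounded a (maxn N a.*2.+1).
  by rewrite geq_max => /andP[? ?]; exists x.
have sS n i j : (i < j)%N -> S n (s i) -> ~ S n (s j).
  move=> /sP[+ _] Si Sj; have := h0P _ _ _ Si Sj.
  by rewrite geq_max => + /andP[_ ?]; lia.
exists s; split=> // [i j /sP[+ _]|n i j Si Sj].
  by rewrite geq_max => /andP[].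
by case: (ltngtP i j) => // /sS /(_ _ _); [move=> /(_ n Si)|move=> /(_ n Sj)].
Qed.

Lemma not_generalized_density_colour :
  ~ generalized_density_ideal R (Exh (@colour_submeasure R)).
Proof.
move=> [_ [mu [mu_lscsm mu_fin mu_dis muE]]].
have sup0 A : (0 <= sup_seq mu A)%E.
  apply: le_ereal_sup_tmp; exists (mu 0%N A); first by exists 0%N.
  by case: (mu_lscsm 0%N).
have supS A B : A `<=` B -> (sup_seq mu A <= sup_seq mu B)%E.
  move=> AB; apply: ge_ereal_sup => _ [n _ <-].
  apply: le_ereal_sup_tmp; exists (mu n B); first by exists n.
  by case: (mu_lscsm n) => _ _ + _ _ _; exact.
have [s [s_incr s_col s_inj]] := colour_selector mu_fin mu_dis.
have : ~ Exh (@colour_submeasure R) (range s).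
  by apply: not_Exh_colour_submeasure => a; exists (s a).
rewrite muE; apply; apply/(ExhP _ sup0 supS) => e e0.
apply: contrapT => Ne.
have e20 : 0 < e / 2 by rewrite divr_gt0.
(* The tails of [range s] have large measure under some [mu n], whose support
   contains only one point of [range s]: that point has large measure. *)
pose Y := [set y | range s y /\ ((e / 2)%:E < sup_seq mu [set y])%E].
have Yunb N : exists2 y, (N <= y)%N & Y y.
  have : ((e / 2)%:E < sup_seq mu (range s `\` `I_N))%E.
    rewrite ltNge; apply/negP => le_e; apply: Ne; exists N.
    by apply: le_lt_trans le_e _; rewrite lte_fin; lra.
  move=> /ereal_sup_gt[_ [n _ <-] lt_e].
  have := lt_le_trans lt_e (lscsm_supp _ (mu_lscsm n)).
  set E := _ `&` _ => ltE.
  have [E0|/set0P[y Ey]] := eqVneq E set0.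
    move: ltE; rewrite E0; case: (mu_lscsm n) => _ -> _ _ _ _.
    by rewrite lte_fin ltNge ltW.
  have [[[i _ si] /= Ny] Sy] := Ey.
  exists y; first by rewrite leqNgt; exact/negP.
  split; first by exists i.
  apply: (lt_le_trans ltE); apply: (@le_trans _ _ (mu n [set y])).
    case: (mu_lscsm n) => _ _ + _ _ _; apply => _ [[[j _ <-] _] Sj].
    by rewrite -si in Sy *; rewrite /= (s_inj n i j Sy Sj).
  by apply: ereal_sup_ubound; exists n.
(* An infinite subset of [Y] that lies in the ideal of [colour_submeasure]. *)
have [k N N' x NN' [Yx xN]||t [t0 tP]] := @sparse_sequence
  (fun _ N y => Y y /\ (N <= colour y)%N) succn.
- by split=> //; exact: leq_trans xN.
- move=> _ N; have [y + Yy] := Yunb (maxn N (s N)).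
  rewrite geq_max => /andP[Ny sNy]; exists y => //; split=> //.
  move: Yy sNy => [[a _ <-] _]; rewrite (s_col a).2 => sNa.
  by rewrite leqNgt; apply/negP => /s_incr; rewrite ltnNge sNa.
have t_incr i j : (i < j)%N -> (t i < t j)%N by move=> /tP[].
have : Exh (@colour_submeasure R) (range t).
  by apply: Exh_colour_submeasure_sparse => i j /tP[? [_ ?]].
rewrite muE => /(ExhP _ sup0 supS) /(_ _ e20)[N]; apply/negP.
rewrite -leNgt; apply: le_trans (ltW (t0 N).1.2) _.
apply: supS => _ ->; split; first by exists N.
by apply/negP; rewrite -leqNgt; exact: increasing_ge_id.
Qed.

End generalized_density.

Theorem theorem1p3 (R : realType) :
  exists I : set (set nat),
    density_like_ideal R I /\ ~ generalized_density_ideal R I.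
Proof.
exists (Exh (@colour_submeasure R)); split; last exact: not_generalized_density_colour.
have phiP := @is_lscsm_colour_submeasure R; split.
  apply: is_ideal_Exh => //; apply: not_Exh_colour_submeasure => a.
  by have [x ax xa] := colour_unbounded a a.*2.+1; exists x.
exists (@colour_submeasure R); split=> //; exact: density_like_colour_submeasure.
Qed.
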